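(* We have: (a) $\mathfrak{g}_{\mathrm{DSO}}(4)=1$. Moreover, if $v\in\mathbb{R}^4$ is irreducible, then $\mathfrak{g}_{\mathrm{DSO}}(v)=1$ if and only if, up to an additive constant and a cyclic shift, $v$ has the form $v=(0,\lambda,0,-\lambda)$ with $\lambda\in\mathbb{R}$, $\lambda\neq 0$. (b) $\mathfrak{g}_{\mathrm{ODJM}}(4)=1$. Moreover, if $a=(a_1,a_2,a_3,a_4)\in\mathbb{R}_+^4$ is irreducible, then $\mathfrak{g}_{\mathrm{ODJM}}(a)=1$ if and only if $a_1a_3=a_2a_4$.
   Context: Write $\mathbb{R}_+ = (0,\infty)$. For $a \in \mathbb{R}_+^p$ and $v \in \mathbb{R}^p$ (here $p=4$), let $J_{a,v}(\theta)$, $\theta \in \mathbb{R}$, be the Hermitian $p\times p$ matrix with diagonal entries $v_1,\dots,v_p$, entries $a_1,\dots,a_{p-1}$ on the first super- and sub-diagonals (i.e. the $(j,j+1)$ and $(j+1,j)$ entries equal $a_j$ for $1\le j\le p-1$), $(1,p)$ entry $e^{-2\pi i \theta}a_p$, $(p,1)$ entry $e^{2\pi i\theta}a_p$, and all other entries zero. (These are the Floquet matrices of the periodic Jacobi matrix $[\mathbf{J}_{a,v}\psi](n) = A(n-1)\psi(n-1)+V(n)\psi(n)+A(n)\psi(n+1)$ on $\ell^2(\mathbb{Z})$, where $A,V$ are the $p$-periodic extensions of $a,v$.) Let $\lambda_1(\theta)\le\cdots\le\lambda_p(\theta)$ be the eigenvalues of $J_{a,v}(\theta)$ counted with multiplicity,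 and put $\lambda_j^- = \min_{\theta\in[0,1]}\lambda_j(\theta)$, $\lambda_j^+ = \max_{\theta\in[0,1]}\lambda_j(\theta)$. It is known that $\lambda_1^-<\lambda_1^+\le\lambda_2^-<\cdots\le\lambda_p^-<\lambda_p^+$. A number $\lambda\in\mathbb{R}$ is a closed gap of $(a,v)$ if $\lambda=\lambda_j^+=\lambda_{j+1}^-$ for some $1\le j\le p-1$. Let $\mathfrak{g}(a,v)$ be the number of closed gaps of $(a,v)$; put $\mathfrak{g}_{\mathrm{DSO}}(v)=\mathfrak{g}(\mathbf{1},v)$ for $v\in\mathbb{R}^p$, where $\mathbf{1}=(1,\dots,1)$, and $\mathfrak{g}_{\mathrm{ODJM}}(a)=\mathfrak{g}(a,\mathbf{0})$ for $a\in\mathbb{R}_+^p$, where $\mathbf{0}=(0,\dots,0)$. Let $\mathrm{cyc}(v_1,\dots,v_p)=(v_2,\dots,v_p,v_1)$. A vector $v \in \mathbb{R}^p$ is irreducible if $v,\mathrm{cyc}(v),\dots,\mathrm{cyc}^{p-1}(v)$ are pairwise distinct, and reducible otherwise. Define $\mathfrak{g}_{\mathrm{DSO}}(p)=\max\{\mathfrak{g}_{\mathrm{DSO}}(v): v\in\mathbb{R}^p \text{ irreducible}\}$ and $\mathfrak{g}_{\mathrm{ODJM}}(p)=\max\{\mathfrak{g}_{\mathrm{ODJM}}(a): a\in\mathbb{R}_+^p\text{ irreducible}\}$. ''Up to an additive constant and a cyclic shift, $v$ has the form $w$'' means that $\mathrm{cyc}^k(v)+c\mathbf{1}=w$ for some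 integer $k \ge 0$ and some $c\in\mathbb{R}$. *)

(* Defs.v *)
From HB Require Import structures.
From mathcomp Require Import all_boot all_order all_algebra.
From mathcomp Require Import finmap.
From mathcomp Require Import all_classical all_reals all_analysis.
From mathcomp Require Import complex.

Set Implicit Arguments.
Unset Strict Implicit.
Unset Printing Implicit Defensive.

Import Order.TTheory GRing.Theory Num.Theory.

Local Open Scope classical_set_scope.
Local Open Scope ring_scope.
Local Open Scope complex_scope.

Definition is_max d (T : porderType d) (A : set T) (x : T) : Prop :=
  A x /\ ubound A x.

Definition is_min d (T : porderType d) (A : set T) (x : T) : Prop :=
  A x /\ lbound A x.

Section Jacobi.
Variable R : realType.

(* The roots in R[i] of the characteristic polynomial, with multiplicity, in
   nondecreasing order of their real parts. It is only used for Hermitian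
   matrices, whose eigenvalues are real, so that Re loses nothing. *)
Definition eigenvalues p (A : 'M[R[i]]_p) : seq R :=
  sort <=%R [seq complex.Re z | z <- sval (closed_field_poly_normal (char_poly A))].

Section Period.
Variable p : nat.
Implicit Types a v : 'rV[R]_p.

(* Indices start at 0: a_(j+1) and v_(j+1) are [a 0 j] and [v 0 j]. At most one
   of the five terms is nonzero when 3 <= p; for p <= 2 the positions overlap
   and the sum is still the Floquet matrix of the periodic operator. *)
Definition floquet a v (theta : R) : 'M[R[i]]_p :=
  let e := Complex (cos (2 * pi * theta)) (sin (2 * pi * theta)) in
  \matrix_(i, j)
    ((v 0 i)%:C *+ (i == j)
     + (a 0 i)%:C *+ (j == i.+1 :> nat)
     + (a 0 j)%:C *+ (i == j.+1 :> nat)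
     + e^* * (a 0 j)%:C *+ ((i == 0 :> nat) && (j.+1 == p :> nat))
     + e * (a 0 i)%:C *+ ((i.+1 == p :> nat) && (j == 0 :> nat))).

(* The range over [0,1] of the eigenvalue function of rank j, where the lowest
   one has rank j = 0. *)
Definition band a v (j : nat) : set R :=
  [set (eigenvalues (floquet a v theta))`_j | theta in `[0, 1]].

Definition closed_gaps a v : set R :=
  [set x | exists j : nat,
     [/\ (j.+1 < p)%N, is_max (band a v j) x & is_min (band a v j.+1) x]].

(* A closed gap is determined by its j < p.-1, so [closed_gaps a v] is finite
   and [fset_set] is the set itself. *)
Definition gap_count a v : nat := #|` fset_set (closed_gaps a v)|%fset.

Definition gap_count_DSO v : nat := gap_count (const_mx 1) v.
Definition gap_count_ODJM a : nat := gap_count a (const_mx 0).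

Definition positive a : Prop := forall i, 0 < a 0 i.

Definition cyc v : 'rV[R]_p := \row_i v 0 (ordS i).

Definition irreducible v : bool := uniq (traject cyc v p).

(* [is_gap_max_DSO m] and [is_gap_max_ODJM m] state that the maximal number of
   closed gaps over irreducible parameters of period p exists and equals m. *)
Definition is_gap_max_DSO (m : nat) : Prop :=
  is_max [set gap_count_DSO v | v in [set v | irreducible v]] m.

Definition is_gap_max_ODJM (m : nat) : Prop :=
  is_max [set gap_count_ODJM a | a in [set a | positive a /\ irreducible a]] m.

End Period.
End Jacobi.

Arguments is_gap_max_DSO : clear implicits.
Arguments is_gap_max_ODJM : clear implicits.

Definition row4 (R : realType) (x0 x1 x2 x3 : R) : 'rV[R]_4 :=
  \row_i [:: x0; x1; x2; x3]`_i.

(* Main.v *)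
Require Import Defs.
From mathcomp Require Import all_boot all_order all_algebra.
From mathcomp Require Import all_classical all_reals all_analysis.
From mathcomp Require Import finmap complex ring lra.
Import Order.TTheory GRing.Theory Num.Theory.
Local Open Scope ring_scope.
Set Implicit Arguments.
Unset Strict Implicit.
Unset Printing Implicit Defensive.

(** For period 4 the characteristic polynomial of the Floquet matrix at [theta]
    is a real quartic [floquet_poly] that depends on [theta] only through
    [c = cos (2 pi theta)], and only in its constant coefficient, which decreases
    strictly as [c] grows because the off-diagonal entries are positive. Two
    real-rooted monic quartics that differ by a nonzero constant have interlacing
    roots ([interlace]), so the second and fourth eigenvalues increase with [c]
    while the first and third decrease. Hence the first and third gaps close exactly at a double root of the antiperiodic
    polynomial ([c = -1]) and the second gap exactly at a double root of the
    periodic one ([c = 1]).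

    At [c = 1] and [c = -1] the Floquet matrix [J] is real symmetric, so a double
    eigenvalue [x] makes [x - J] have rank at most 2, and all its cofactors
    vanish ([cofactors_eq0]). A few of these cofactors are enough to read off
    the parameters. A double antiperiodic eigenvalue forces the parameter to be
    fixed by two cyclic shifts, so an irreducible parameter can close only the
    middle gap, and its gap count is 0 or 1 ([gap_count_periodic]). A double
    periodic eigenvalue forces the shape [(0, lambda, 0, - lambda)] of a
    Schroedinger potential, and the identity [a0 * a2 = a1 * a3] for an
    off-diagonal operator, where the eigenvalue is 0. Conversely such parameters
    visibly have a double periodic eigenvalue. *)

(** * The Floquet characteristic polynomial *)

(** The corner entries [- b] and [- b'] of a cyclic Jacobi matrix enter its
    determinant only through [a3sq = b * b'] and the holonomy [hol = b + b'],
    and these are real for the Floquet matrix although [b] is not. *)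
Definition cyclic_det {S : comNzRingType} (w0 w1 w2 w3 a0 a1 a2 a3sq hol : S) : S :=
  w0 * w1 * w2 * w3 - a0 ^+ 2 * (w2 * w3) - a1 ^+ 2 * (w0 * w3)
  - a2 ^+ 2 * (w0 * w1) - a3sq * (w1 * w2) + a0 ^+ 2 * a2 ^+ 2
  + a1 ^+ 2 * a3sq - a0 * a1 * a2 * hol.

Lemma rmorph_cyclic_det (S T : comNzRingType) (f : {rmorphism S -> T})
    (w0 w1 w2 w3 a0 a1 a2 a3sq hol : S) :
  f (cyclic_det w0 w1 w2 w3 a0 a1 a2 a3sq hol) =
  cyclic_det (f w0) (f w1) (f w2) (f w3) (f a0) (f a1) (f a2) (f a3sq) (f hol).
Proof.
by rewrite /cyclic_det !(rmorphB, rmorphD) !(rmorphM, rmorphXn) /=.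
Qed.

(** Entries are read from a function on [nat] so that the minors of a matrix given
    by a list of rows reduce by computation. *)
Lemma det3 (S : comNzRingType) (M : 'M[S]_3) (f : nat -> nat -> S) :
  (forall i j, M i j = f i j) ->
  \det M = f 0 0 * (f 1 1 * f 2 2 - f 1 2 * f 2 1)
         - f 0 1 * (f 1 0 * f 2 2 - f 1 2 * f 2 0)
         + f 0 2 * (f 1 0 * f 2 1 - f 1 1 * f 2 0).
Proof.
move=> Mf.
rewrite (expand_det_row _ ord0) !big_ord_recl big_ord0 /cofactor.
rewrite !(expand_det_row _ ord0) !big_ord_recl !big_ord0 /cofactor !det_mx11.
rewrite !mxE !Mf /=.
rewrite /bump /=; ring.
Qed.

Lemma det_cyclic_jacobi (S : comNzRingType) (M : 'M[S]_4)
    (w0 w1 w2 w3 a0 a1 a2 b b' : S) :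
  M = \matrix_(i, j) (nth [::] [:: [:: w0; - a0; 0; - b'];
                             [:: - a0; w1; - a1; 0];
                             [:: 0; - a1; w2; - a2];
                             [:: - b; 0; - a2; w3]] i)`_j ->
  \det M = cyclic_det w0 w1 w2 w3 a0 a1 a2 (b * b') (b + b').
Proof.
move=> ->.
set rows := [:: _; _; _; _].
rewrite (expand_det_row _ ord0) !big_ord_recl big_ord0 /cofactor !mxE.
rewrite (@det3 _ _ (fun i j => (nth [::] rows i.+1)`_j.+1)); last first.
  by move=> i j; rewrite !mxE.
rewrite (@det3 _ _ (fun i j => (nth [::] rows i.+1)`_(bump 1 j))); last first.
  by move=> i j; rewrite !mxE.
rewrite (@det3 _ _ (fun i j => (nth [::] rows i.+1)`_(bump 2 j))); last first.
  by move=> i j; rewrite !mxE.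
rewrite (@det3 _ _ (fun i j => (nth [::] rows i.+1)`_(bump 3 j))); last first.
  by move=> i j; rewrite !mxE.
rewrite /rows /bump /= /cyclic_det.
ring.
Qed.

Section FloquetPolynomial.
Variable R : realType.
Local Notation C := R[i].

Local Open Scope complex_scope.

(** For an eigenvector [u], the scalar [u A u^*] is self-conjugate and equals
    [z |u|^2]. *)
Lemma hermitian_eigenvalue_real n (A : 'M[C]_n) z :
  (forall i j, (A i j)^* = A j i) -> root (char_poly A) z -> complex.Im z = 0.
Proof.
move=> hA; rewrite -eigenvalue_root_char => /eigenvalueP[u uA u0].
pose u' : 'cV[C]_n := \col_i (u 0 i)^*.
pose s := (u *m u') 0 0.
have s0 : 0 < s.
  rewrite /s mxE lt0r; apply/andP; split; last first.
    by apply: sumr_ge0 => i _; rewrite mxE mulcJ_ge0.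
  apply: contra u0 => /eqP /psumr_eq0P h.
  apply/eqP/rowP => i; rewrite mxE; apply/eqP.
  have := h _ i isT; rewrite mxE => /(_ _)/eqP; rewrite mulf_eq0 conjc_eq0 orbb.
  by apply => j _; rewrite mxE mulcJ_ge0.
have sJ : s^* = s by apply/conj_Creal/gtr0_real.
have q : (u *m A *m u') 0 0 = z * s.
  by rewrite uA -scalemxAl mxE.
have : ((u *m A *m u') 0 0)^* = (u *m A *m u') 0 0.
  rewrite -mulmxA [in RHS]mulmxA !mxE rmorph_sum.
  apply: eq_bigr => i _; rewrite rmorphM !mxE rmorph_sum mulrC; congr (_ * _).
  by apply: eq_bigr => j _; rewrite !mxE rmorphM /= hA conjcK mulrC.
rewrite q rmorphM /= sJ => /(mulIf (lt0r_neq0 s0)).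
case: z {uA q} => x y /= [] /eqP; rewrite -subr_eq0 -opprD oppr_eq0.
by rewrite -mulr2n mulrn_eq0 => /eqP.
Qed.

Definition floquet_poly (a0 a1 a2 a3 v0 v1 v2 v3 c : R) : {poly R} :=
  cyclic_det ('X - v0%:P) ('X - v1%:P) ('X - v2%:P) ('X - v3%:P)
    a0%:P a1%:P a2%:P (a3 ^+ 2)%:P (2 * a3 * c)%:P.

Variables (a0 a1 a2 a3 v0 v1 v2 v3 th : R).
Let a := row4 a0 a1 a2 a3.
Let v := row4 v0 v1 v2 v3.

Lemma floquet_herm i j : (floquet a v th i j)^* = floquet a v th j i.
Proof.
rewrite !mxE.
by case: i => [[|[|[|[|i]]]] Hi] //; case: j => [[|[|[|[|j]]]] Hj] //;
  apply/eqP; rewrite eq_complex /=; apply/andP; split; apply/eqP; ring.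
Qed.

Lemma char_poly_floquet : char_poly (floquet a v th) =
  map_poly (real_complex R)
    (floquet_poly a0 a1 a2 a3 v0 v1 v2 v3 (cos (2 * pi * th))).
Proof.
set e : C := Complex (cos (2 * pi * th)) (sin (2 * pi * th)).
pose m (x : R) : {poly C} := (x%:C)%:P.
rewrite /char_poly (@det_cyclic_jacobi _ _
  ('X - m v0) ('X - m v1) ('X - m v2) ('X - m v3)
  (m a0) (m a1) (m a2) (e * a3%:C)%:P (e^* * a3%:C)%:P); last first.
  apply/matrixP => i j; rewrite !mxE -/e; clearbody e.
  by case: i => [[|[|[|[|i]]]] Hi] //; case: j => [[|[|[|[|j]]]] Hj] //=;
  rewrite ?(mulr0n, mulr1n, mulr0, addr0, add0r, subr0, sub0r, oppr0).
rewrite -polyCM -polyCD.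
have -> : e * a3%:C * (e^* * a3%:C) = (a3 ^+ 2)%:C.
  rewrite mulrACA -sqr_normc -add_Re2_Im2 /= cos2Dsin2 rmorph1 mul1r.
  by rewrite -rmorphM.
have -> : e * a3%:C + e^* * a3%:C = (2 * a3 * cos (2 * pi * th))%:C.
  by rewrite -mulrDl addcJ /= !rmorphM /= rmorph_nat mulrAC.
rewrite /floquet_poly rmorph_cyclic_det /m.
by rewrite !rmorphB /= !map_polyX !map_polyC.
Qed.

Lemma eigenvalues_floquet : let s := eigenvalues (floquet a v th) in
  [/\ sorted <=%R s, size s = 4 & \prod_(x <- s) ('X - x%:P) =
   floquet_poly a0 a1 a2 a3 v0 v1 v2 v3 (cos (2 * pi * th))].
Proof.
rewrite /= /eigenvalues; case: closed_field_poly_normal => r /=.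
rewrite (monicP (char_poly_monic _)) scale1r => Er.
split; first exact/sort_sorted/le_total.
  rewrite size_sort size_map; apply: succn_inj.
  by rewrite -(size_prod_XsubC r id) -Er size_char_poly.
apply: (@map_poly_inj _ _ (real_complex R)).
rewrite -char_poly_floquet [RHS]Er map_prod_XsubC.
rewrite (perm_big _ (permEl (perm_sort _ _))) /= big_map.
apply: eq_big_seq => z zr; congr ('X - _%:P).
have : complex.Im z = 0.
  apply: (hermitian_eigenvalue_real floquet_herm).
  by rewrite Er root_prod_XsubC.
by case: z {zr} => x y /= ->.
Qed.

End FloquetPolynomial.

(** * Interlacing of real-rooted quartics *)

(** Monic quartics that differ by a constant share the elementary symmetric
    functions [e1], [e2], [e3] of their roots, hence the first two power sums. *)
Lemma power_sums_eq (R : realFieldType) (x0 x1 x2 x3 y0 y1 y2 y3 d : R) :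
  (forall t, (t - x0) * (t - x1) * (t - x2) * (t - x3)
             = (t - y0) * (t - y1) * (t - y2) * (t - y3) + d) ->
  x0 + x1 + x2 + x3 = y0 + y1 + y2 + y3 /\
  x0 ^+ 2 + x1 ^+ 2 + x2 ^+ 2 + x3 ^+ 2 = y0 ^+ 2 + y1 ^+ 2 + y2 ^+ 2 + y3 ^+ 2.
Proof.
move=> h.
(* The differences of these four identities no longer involve [d]; they equate
   the coefficients of degrees 1, 2 and 3. *)
have H0 := h 0; have H1 := h 1; have H2 := h (-1); have H3 := h 2.
have E1 : x0 + x1 + x2 + x3 = y0 + y1 + y2 + y3 by lra.
split=> //.
have E2 : (x0 + x1 + x2 + x3) ^+ 2 = (y0 + y1 + y2 + y3) ^+ 2 by rewrite E1.
lra.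
Qed.

(** The roots [x] lie where the [y]-quartic equals [- d < 0], that is in the two
    intervals [(y0, y1)] and [(y2, y3)]. Signs allow only the splittings 4 + 0,
    2 + 2 and 0 + 4 between them, and equality of the power sums leaves 2 + 2. *)
Lemma interlace (R : realFieldType) (x0 x1 x2 x3 y0 y1 y2 y3 d : R) :
  0 < d -> x0 <= x1 <= x2 -> x2 <= x3 -> y0 <= y1 <= y2 -> y2 <= y3 ->
  (forall t, (t - x0) * (t - x1) * (t - x2) * (t - x3)
             = (t - y0) * (t - y1) * (t - y2) * (t - y3) + d) ->
  [/\ y0 < x0, x1 < y1, y2 < x2 & x3 < y3].
Proof.
move=> d0 /andP[x01 x12] x23 /andP[y01 y12] y23 h.
have [s1 s2] := @power_sums_eq _ _ _ _ _ _ _ _ _ _ h.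
pose Q t := (t - y0) * (t - y1) * (t - y2) * (t - y3).
have Qx t : t \in [:: x0; x1; x2; x3] -> Q t < 0.
  move=> tx; have := h t.
  have -> : (t - x0) * (t - x1) * (t - x2) * (t - x3) = 0.
    by move: tx; rewrite !inE => /or4P[] /eqP ->; rewrite subrr ?(mul0r, mulr0).
  rewrite -/(Q t); lra.
have loc t : Q t < 0 -> (y0 < t < y1) || (y2 < t < y3).
  rewrite ltNge; apply: contraR; rewrite negb_or /Q.
  move=> /andP[n1 n2].
  have : 0 <= (t - y0) * (t - y1).
    case: (lerP t y0) n1 => /= [a _|a]; first by apply: mulr_le0; lra.
    by rewrite -leNgt => b; apply: mulr_ge0; lra.
  have : 0 <= (t - y2) * (t - y3).
    case: (lerP t y2) n2 => /= [a _|a]; first by apply: mulr_le0; lra.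
    by rewrite -leNgt => b; apply: mulr_ge0; lra.
  by move=> p q; rewrite -mulrA; apply: mulr_ge0.
have l0 : (y0 < x0 < y1) || (y2 < x0 < y3) by apply/loc/Qx; rewrite !inE eqxx ?orbT.
have l1 : (y0 < x1 < y1) || (y2 < x1 < y3) by apply/loc/Qx; rewrite !inE eqxx ?orbT.
have l2 : (y0 < x2 < y1) || (y2 < x2 < y3) by apply/loc/Qx; rewrite !inE eqxx ?orbT.
have l3 : (y0 < x3 < y1) || (y2 < x3 < y3) by apply/loc/Qx; rewrite !inE eqxx ?orbT.
(* The [x]-quartic equals [d] at each [y], so an even number of the [x] lies on
   either side of [y1], and of [y2]. *)
have pos : 0 < (y1 - x0) * (y1 - x1) * (y1 - x2) * (y1 - x3).
  by rewrite h subrr mulr0 !mul0r add0r.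
have pos' : 0 < (y2 - x0) * (y2 - x1) * (y2 - x2) * (y2 - x3).
  by rewrite h subrr mulr0 mul0r add0r.
(* The sums of a quadratic over the two root sets agree. With [p, q] the ends of
   an interval that contains all the [x], it is positive on every [x] and
   nonpositive on every [y]: this excludes four roots in one interval. *)
have mom (p q : R) : \sum_(x <- [:: x0; x1; x2; x3]) (x - p) * (q - x)
                   = \sum_(y <- [:: y0; y1; y2; y3]) (y - p) * (q - y).
  rewrite !big_cons !big_nil.
  have -> : forall u0 u1 u2 u3 : R, (u0 - p) * (q - u0) + ((u1 - p) * (q - u1)
    + ((u2 - p) * (q - u2) + ((u3 - p) * (q - u3) + 0)))
    = (p + q) * (u0 + u1 + u2 + u3) - (u0 ^+ 2 + u1 ^+ 2 + u2 ^+ 2 + u3 ^+ 2)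
      - 4 * p * q by move=> *; ring.
  by rewrite s1 s2; ring.
have x1y1 : x1 < y1.
  rewrite ltNge; apply/negP => a.
  have b0 : y2 < x1 by case/orP: l1 => /andP[]; lra.
  have b1 : y2 < x2 by lra.
  case/orP: l0 => /andP[c1 c2].
    have : 0 < (y2 - x0) * ((x1 - y2) * ((x2 - y2) * (y2 - x3))).
      by move: pos'; congr (0 < _); ring.
    rewrite pmulr_rgt0 ?pmulr_rgt0; lra.
  have := mom y2 y3; rewrite !big_cons !big_nil !subrr !(mul0r, mulr0).
  have k t : y2 < t -> t <= x3 -> 0 < (t - y2) * (y3 - t).
    by move=> ? ?; apply: mulr_gt0; case/orP: l3 => /andP[]; lra.
  have := k _ c1 (le_trans x01 (le_trans x12 x23)).
  have := k _ b0 (le_trans x12 x23).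
  have := k _ b1 x23.
  have := k _ (lt_le_trans b1 x23) (lexx _).
  have : (y0 - y2) * (y3 - y0) <= 0 by apply: mulr_le0_ge0; lra.
  have : (y1 - y2) * (y3 - y1) <= 0 by apply: mulr_le0_ge0; lra.
  lra.
have y2x2 : y2 < x2.
  rewrite ltNge; apply/negP => a.
  have b2 : x2 < y1 by case/orP: l2 => /andP[]; lra.
  case/orP: l3 => /andP[c1 c2]; last first.
    have : 0 < (y1 - x0) * ((y1 - x1) * ((y1 - x2) * (y1 - x3))).
      by move: pos; congr (0 < _); ring.
    rewrite !pmulr_rgt0; lra.
  have := mom y0 y1; rewrite !big_cons !big_nil !subrr !(mul0r, mulr0).
  have k t : x0 <= t -> t < y1 -> 0 < (t - y0) * (y1 - t).
    by move=> ? ?; apply: mulr_gt0; case/orP: l0 => /andP[]; lra.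
  have := k _ (lexx _) (le_lt_trans x01 x1y1).
  have := k _ x01 x1y1.
  have := k _ (le_trans x01 x12) b2.
  have := k _ (le_trans x01 (le_trans x12 x23)) c2.
  have : (y2 - y0) * (y1 - y2) <= 0 by apply: mulr_ge0_le0; lra.
  have : (y3 - y0) * (y1 - y3) <= 0 by apply: mulr_ge0_le0; lra.
  lra.
split=> //.
  by case/orP: l0 => /andP[]; lra.
by case/orP: l3 => /andP[]; lra.
Qed.

Lemma sorted4P (R : realType) (s : seq R) : sorted <=%R s -> size s = 4 ->
  exists x0 x1 x2 x3, [/\ s = [:: x0; x1; x2; x3], x0 <= x1, x1 <= x2 & x2 <= x3].
Proof.
case: s => [|x0 [|x1 [|x2 [|x3 [|]]]]] //= /and4P[? ? ? _] _.
by exists x0, x1, x2, x3.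
Qed.

Lemma interlace_seq (R : realType) (xs ys : seq R) (d : R) :
  sorted <=%R xs -> sorted <=%R ys -> size xs = 4 -> size ys = 4 -> 0 < d ->
  \prod_(x <- xs) ('X - x%:P) = \prod_(y <- ys) ('X - y%:P) + d%:P ->
  [/\ ys`_0 < xs`_0, xs`_1 < ys`_1, ys`_2 < xs`_2 & xs`_3 < ys`_3].
Proof.
move=> sx sy zx zy d0.
have [x0 [x1 [x2 [x3 [-> x01 x12 x23]]]]] := sorted4P sx zx.
have [y0 [y1 [y2 [y3 [-> y01 y12 y23]]]]] := sorted4P sy zy.
rewrite !big_cons !big_nil !mulr1 => e.
apply: (interlace d0) => //; rewrite ?x01 ?y01 // => t.
move/(congr1 (horner^~ t)): e.
by rewrite !(hornerD, hornerN, hornerM, hornerX, hornerC) !mulrA.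
Qed.

(** The derivative is written [deriv q] because the postfix prime notation is
    the analytic derivative here. *)
Definition double_root (R : realType) (q : {poly R}) x :=
  root q x && root (deriv q) x.

Lemma double_rootP (R : realType) (s : seq R) x : sorted <=%R s -> size s = 4 ->
  double_root (\prod_(y <- s) ('X - y%:P)) x <->
  exists2 i, (i < 3)%N & s`_i = x /\ s`_i.+1 = x.
Proof.
move=> ss sz; have [x0 [x1 [x2 [x3 [-> le01 le12 le23]]]]] := sorted4P ss sz.
rewrite !big_cons big_nil mulr1 /double_root /root.
rewrite !(derivD, derivN, derivM, derivX, derivC).
rewrite !(hornerD, hornerN, hornerM, hornerX, hornerC).
split=> [/andP[/eqP r /eqP r']|[i i3 /= [xi xSi]]]; last first.
  case: i i3 xi xSi => [|[|[|//]]] _ /= <- => [->|->|->];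
    apply/andP; split; apply/eqP; ring.
have : [\/ x = x0 /\ x = x1, x = x1 /\ x = x2 | x = x2 /\ x = x3].
  move/eqP: r; rewrite !mulf_eq0 !subr_eq0 => /or4P[] /eqP xi; subst x;
    move: r'; rewrite !(subrr, mulr0, mul0r, mul1r, mulr1, add0r, addr0) => /eqP;
    rewrite ?mulf_eq0 ?subr_eq0 oner_eq0 ?orbF /= -?orbA => /or3P[] /eqP e;
    first [apply: Or31; split; lra | apply: Or32; split; lra
             | apply: Or33; split; lra].
case=> -[e1 e2]; [exists 0%N|exists 1%N|exists 2%N] => //=; by split.
Qed.

(** * Closed gaps and double roots *)

Section Gaps.
Variable R : realType.
Variables (a0 a1 a2 a3 v0 v1 v2 v3 : R).
Hypothesis a_gt0 : 0 < a0 * a1 * a2 * a3.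
Let a := row4 a0 a1 a2 a3.
Let v := row4 v0 v1 v2 v3.
Let F := floquet_poly a0 a1 a2 a3 v0 v1 v2 v3.
Let E th := eigenvalues (floquet a v th).

Lemma floquet_polyD c c' :
  F c = F c' + (2 * (a0 * a1 * a2 * a3) * (c' - c))%:P.
Proof.
by rewrite /F /floquet_poly /cyclic_det !(rmorphM, rmorphB) /=; ring.
Qed.

Lemma eigenvalues_lt th th' : cos (2 * pi * th) < cos (2 * pi * th') ->
  [/\ (E th')`_0 < (E th)`_0, (E th)`_1 < (E th')`_1,
      (E th')`_2 < (E th)`_2 & (E th)`_3 < (E th')`_3].
Proof.
move=> cc.
have [s z p] := eigenvalues_floquet a0 a1 a2 a3 v0 v1 v2 v3 th.
have [s' z' p'] := eigenvalues_floquet a0 a1 a2 a3 v0 v1 v2 v3 th'.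
have d_gt0 : 0 < 2 * (a0 * a1 * a2 * a3) * (cos (2 * pi * th') - cos (2 * pi * th)).
  by rewrite mulr_gt0 ?subr_gt0 ?(mulr_gt0 (ltr0n _ 2)).
have pD := floquet_polyD (cos (2 * pi * th)) (cos (2 * pi * th')).
rewrite /F -p -p' in pD.
exact: (interlace_seq s s' z z' d_gt0 pD).
Qed.

Lemma eigenvalues_le th th' : cos (2 * pi * th) <= cos (2 * pi * th') ->
  [/\ (E th')`_0 <= (E th)`_0, (E th)`_1 <= (E th')`_1,
      (E th')`_2 <= (E th)`_2 & (E th)`_3 <= (E th')`_3].
Proof.
rewrite le_eqVlt => /predU1P[cc|/eigenvalues_lt[/ltW ? /ltW ? /ltW ? /ltW ?] //].
suff -> : E th = E th' by [].
have [s z p] := eigenvalues_floquet a0 a1 a2 a3 v0 v1 v2 v3 th.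
have [s' z' p'] := eigenvalues_floquet a0 a1 a2 a3 v0 v1 v2 v3 th'.
rewrite cc -p' in p.
exact: (le_sorted_eq s s' (prod_XsubC_eq p)).
Qed.

Lemma cos_2pi0 : cos (2 * pi * 0) = 1 :> R.
Proof. by rewrite mulr0 cos0. Qed.

Lemma cos_2pi_half : cos (2 * pi * 2^-1) = -1 :> R.
Proof. by rewrite mulrAC divff ?mul1r ?cospi. Qed.

(** By monotonicity in [cos (2 pi theta)], each band ends at [theta = 0] and at
    [theta = 1/2], in an order that alternates with the rank. *)
Lemma band_ends :
  [/\ is_max (band a v 0) (E 2^-1)`_0, is_min (band a v 1) (E 2^-1)`_1,
      is_max (band a v 1) (E 0)`_1, is_min (band a v 2) (E 0)`_2 &
      is_max (band a v 2) (E 2^-1)`_2 /\ is_min (band a v 3) (E 2^-1)`_3].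
Proof.
have h th : cos (2 * pi * 2^-1) <= cos (2 * pi * th) :> R.
  by rewrite cos_2pi_half cos_geN1.
have k th : cos (2 * pi * th) <= cos (2 * pi * 0) :> R.
  by rewrite cos_2pi0 cos_le1.
have m0 j : band a v j (E 0)`_j.
  by exists 0 => //=; rewrite in_itv /= lexx ler01.
have m1 j : band a v j (E 2^-1)`_j.
  by exists 2^-1 => //=; rewrite in_itv /=; apply/andP; split; lra.
split; last split.
- by split; [exact: m1|move=> _ [th _ <-]; case: (eigenvalues_le (h th))].
- by split; [exact: m1|move=> _ [th _ <-]; case: (eigenvalues_le (h th))].
- by split; [exact: m0|move=> _ [th _ <-]; case: (eigenvalues_le (k th))].
- by split; [exact: m0|move=> _ [th _ <-]; case: (eigenvalues_le (k th))].
- by split; [exact: m1|move=> _ [th _ <-]; case: (eigenvalues_le (h th))].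
- by split; [exact: m1|move=> _ [th _ <-]; case: (eigenvalues_le (h th))].
Qed.

Lemma is_max_uniq (A : set R) x y : is_max A x -> is_max A y -> x = y.
Proof. by move=> [Ax ux] [Ay uy]; apply/le_anti/andP; split; [exact: uy|exact: ux]. Qed.

Lemma is_min_uniq (A : set R) x y : is_min A x -> is_min A y -> x = y.
Proof. by move=> [Ax ux] [Ay uy]; apply/le_anti/andP; split; [exact: ux|exact: uy]. Qed.

(** Without a double antiperiodic root the outer gaps are open; strict interlacing
    with the antiperiodic eigenvalues leaves the two middle periodic eigenvalues
    as the only possible double root at [c = 1]. *)
Lemma gap_count_periodic : (forall x, ~ double_root (F (-1)) x) ->
  gap_count a v = `[< exists x, double_root (F 1) x >] :> nat.
Proof.
move=> noap.
have [b0 b1 b1' b2 [b2' b3]] := band_ends.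
have [s z] := eigenvalues_floquet a0 a1 a2 a3 v0 v1 v2 v3 2^-1.
rewrite -/a -/v -/(E _) cos_2pi_half -/F => p.
have [s' z'] := eigenvalues_floquet a0 a1 a2 a3 v0 v1 v2 v3 0.
rewrite -/a -/v -/(E _) cos_2pi0 -/F => p'.
have gaps : closed_gaps a v = [set x | (E 0)`_1 = x /\ (E 0)`_2 = x]%classic.
  apply/seteqP; split=> x; last first.
    move=> [<- e]; exists 1%N; split; [by []|exact: b1'|].
    by rewrite -e; exact: b2.
  move=> [[|[|[|j]]] [j4 mx mn]]; last by [].
  - have e0 := is_max_uniq mx b0; have e1 := is_min_uniq mn b1.
    case: (noap x); rewrite -p; apply/(double_rootP x s z); exists 0%N; first by [].
    by split; [rewrite e0|rewrite e1].
  - by split; [exact: is_max_uniq b1' mx|exact: is_min_uniq b2 mn].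
  - have e0 := is_max_uniq mx b2'; have e1 := is_min_uniq mn b3.
    case: (noap x); rewrite -p; apply/(double_rootP x s z); exists 2%N; first by [].
    by split; [rewrite e0|rewrite e1].
have [l0 l1 l2 l3] : [/\ (E 0)`_0 < (E 2^-1)`_0, (E 2^-1)`_1 < (E 0)`_1,
                     (E 0)`_2 < (E 2^-1)`_2 & (E 2^-1)`_3 < (E 0)`_3].
  by apply: eigenvalues_lt; rewrite cos_2pi_half cos_2pi0; lra.
have [y01 y23] : (E 2^-1)`_0 <= (E 2^-1)`_1 /\ (E 2^-1)`_2 <= (E 2^-1)`_3.
  by have [x0 [x1 [x2 [x3 [Ex ? _ ?]]]]] := sorted4P s z; rewrite /E Ex.
have dbl x : double_root (F 1) x <-> (E 0)`_1 = x /\ (E 0)`_2 = x.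
  rewrite -p'; apply: (iff_trans (double_rootP x s' z')).
  split=> [[[|[|[|i]]] i3 [e1 e2]]|]; [ | | |by []|by exists 1%N].
  - by have := lt_trans (lt_le_trans l0 y01) l1; rewrite e1 e2 ltxx.
  - by [].
  - by have := lt_trans (lt_le_trans l2 y23) l3; rewrite e1 e2 ltxx.
rewrite /gap_count gaps.
case: asboolP => [[x /dbl[e1 e2]]|no].
  rewrite (_ : [set _ | _]%classic = [set x]%classic) ?fset_set1 ?cardfs1 //.
  by apply/seteqP; split=> y /=; rewrite e1 e2; [case|move=> ->].
rewrite (_ : [set _ | _]%classic = set0) ?fset_set0 ?cardfs0 //.
by apply/seteqP; split=> y //= /dbl dy; apply: no; exists y.
Qed.
End Gaps.

(** * Double eigenvalues at the band edges *)

(** For a symmetric 4 x 4 matrix [M], the sum of the squares of all cofactors is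
    [(tr adj M)^2 - 2 det M * e2 M]: in terms of the eigenvalues of [M], those of
    [adj M] are their triple products. The hypotheses are [det M = 0] and
    [tr adj M = 0], that is a double eigenvalue 0, so every cofactor is 0; the
    three listed are those at the positions (0,2), (1,3) and (0,1). *)
Lemma cofactors_eq0 (R : realFieldType) (w0 w1 w2 w3 a0 a1 a2 b : R) :
  w0 * w1 * w2 * w3 - a0 ^+ 2 * (w2 * w3) - a1 ^+ 2 * (w0 * w3)
  - a2 ^+ 2 * (w0 * w1) - b ^+ 2 * (w1 * w2) + a0 ^+ 2 * a2 ^+ 2
  + a1 ^+ 2 * b ^+ 2 - a0 * a1 * a2 * (2 * b) = 0 ->
  (w1 * w2 * w3 - a1 ^+ 2 * w3 - a2 ^+ 2 * w1)
  + (w0 * w2 * w3 - a2 ^+ 2 * w0 - b ^+ 2 * w2)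
  + (w0 * w1 * w3 - a0 ^+ 2 * w3 - b ^+ 2 * w1)
  + (w0 * w1 * w2 - a0 ^+ 2 * w2 - a1 ^+ 2 * w0) = 0 ->
  [/\ a0 * a1 * w3 + a2 * b * w1 = 0, a1 * a2 * w0 + a0 * b * w2 = 0
    & a0 * (w2 * w3 - a2 ^+ 2) + a1 * a2 * b = 0].
Proof.
set D := (X in X = 0 -> _); move=> D0.
set m0 := _ - _ - a2 ^+ 2 * w1; set m1 := _ - _ - b ^+ 2 * w2.
set m2 := _ - _ - b ^+ 2 * w1; set m3 := _ - _ - a1 ^+ 2 * w0; move=> T0.
set p := (X in [/\ X = 0, _ & _]); set q := (X in [/\ _, X = 0 & _]).
set r := (X in [/\ _, _ & X = 0]).
pose m12 := a1 * (w0 * w3 - b ^+ 2) + a0 * a2 * b.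
pose m23 := a2 * (w0 * w1 - a0 ^+ 2) + a0 * a1 * b.
pose m03 := b * (w1 * w2 - a1 ^+ 2) + a0 * a1 * a2.
(* [m] are the principal cofactors and [p, q, r, m12, m23, m03] the others. The
   last factor is the second elementary symmetric function [e2] of the matrix. *)
have E : m0 ^+ 2 + m1 ^+ 2 + m2 ^+ 2 + m3 ^+ 2
  + 2 * (p ^+ 2 + q ^+ 2 + r ^+ 2 + m12 ^+ 2 + m23 ^+ 2 + m03 ^+ 2)
  = (m0 + m1 + m2 + m3) ^+ 2 - 2 * D *
   (w0 * w1 + w0 * w2 + w0 * w3 + w1 * w2 + w1 * w3 + w2 * w3
    - a0 ^+ 2 - a1 ^+ 2 - a2 ^+ 2 - b ^+ 2).
  rewrite /m0 /m1 /m2 /m3 /p /q /r /m12 /m23 /m03 /D; ring.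
move: E; rewrite T0 D0 expr0n /= mulr0 mul0r subr0 => E.
have := sqr_ge0 m0; have := sqr_ge0 m1; have := sqr_ge0 m2; have := sqr_ge0 m3.
have := sqr_ge0 m12; have := sqr_ge0 m23; have := sqr_ge0 m03.
have := sqr_ge0 p; have := sqr_ge0 q; have := sqr_ge0 r.
clearbody p q r m0 m1 m2 m3 m12 m23 m03 => *.
by split; apply/eqP; rewrite -sqrf_eq0; apply/eqP; lra.
Qed.

(** The derivative of the characteristic polynomial at [x] is the trace of the
    adjugate of [x - J]; with [c = 1] or [c = -1] the corner entry of [J] is the
    real number [c * a3]. *)
Lemma double_root_cofactors (R : realType) (a0 a1 a2 a3 v0 v1 v2 v3 c x : R) :
  c ^+ 2 = 1 -> double_root (floquet_poly a0 a1 a2 a3 v0 v1 v2 v3 c) x ->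
  [/\ a0 * a1 * (x - v3) + a2 * (c * a3) * (x - v1) = 0,
      a1 * a2 * (x - v0) + a0 * (c * a3) * (x - v2) = 0
    & a0 * ((x - v2) * (x - v3) - a2 ^+ 2) + a1 * a2 * (c * a3) = 0].
Proof.
move=> c2; rewrite /double_root /floquet_poly /root /cyclic_det.
move=> /andP[/eqP r /eqP]; move: r; rewrite ?expr2 !(derivD, derivN, derivM, derivX, derivC).
rewrite !(hornerD, hornerN, hornerM, hornerX, hornerC, horner_exp) => r r'.
have b2 : (c * a3) ^+ 2 = a3 ^+ 2 by rewrite exprMn c2 mul1r.
apply: (@cofactors_eq0 _ (x - v0) (x - v1) (x - v2) (x - v3) a0 a1 a2 (c * a3)).
  by rewrite b2 -[RHS]r; ring.
by rewrite b2 -[RHS]r'; ring.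
Qed.

Lemma double_rootE (R : realType) (a0 a1 a2 a3 v0 v1 v2 v3 c x : R) :
  cyclic_det (x - v0) (x - v1) (x - v2) (x - v3)
    a0 a1 a2 (a3 ^+ 2) (2 * a3 * c) = 0 ->
  (x - v1) * (x - v2) * (x - v3) + (x - v0) * (x - v2) * (x - v3)
  + (x - v0) * (x - v1) * (x - v3) + (x - v0) * (x - v1) * (x - v2)
  - a0 ^+ 2 * (2 * x - v2 - v3) - a1 ^+ 2 * (2 * x - v0 - v3)
  - a2 ^+ 2 * (2 * x - v0 - v1) - a3 ^+ 2 * (2 * x - v1 - v2) = 0 ->
  double_root (floquet_poly a0 a1 a2 a3 v0 v1 v2 v3 c) x.
Proof.
rewrite /double_root /floquet_poly /root /cyclic_det => e e'.
apply/andP; split; apply/eqP; rewrite ?expr2.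
  rewrite !(hornerD, hornerN, hornerM, hornerX, hornerC).
  by rewrite -[RHS]e; ring.
rewrite !(derivD, derivN, derivM, derivX, derivC).
rewrite !(hornerD, hornerN, hornerM, hornerX, hornerC).
by rewrite -[RHS]e'; ring.
Qed.

Lemma DSO_periodic_double_root (R : realType) (v0 v1 v2 v3 x : R) :
  double_root (floquet_poly 1 1 1 1 v0 v1 v2 v3 1) x ->
  (v0 = x /\ v2 = x /\ v1 + v3 = 2 * x) \/ (v1 = x /\ v3 = x /\ v0 + v2 = 2 * x).
Proof.
move/double_root_cofactors; rewrite !(expr1n, mul1r) => -[//|p q r].
have : (v0 - x) * (v1 - x) = 0.
  have -> : v0 = 2 * x - v2 by lra.
  have -> : v1 = 2 * x - v3 by lra.
  by rewrite -[RHS]r; ring.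
by move=> /eqP; rewrite mulf_eq0 => /orP[] /eqP ?; [left|right]; split; [|split| |split]; lra.
Qed.

Lemma DSO_antiperiodic_double_root (R : realType) (v0 v1 v2 v3 x : R) :
  double_root (floquet_poly 1 1 1 1 v0 v1 v2 v3 (-1)) x -> v0 = v2 /\ v1 = v3.
Proof.
move/double_root_cofactors; rewrite !(sqrrN, expr1n, mulr1, mul1r) => -[//|p q r].
by split; lra.
Qed.

(** The cofactor at (0,2) is [(a0 * a1 + a2 * a3) * x], so [x = 0]; the one at
    (0,1) then gives the identity. *)
Lemma ODJM_periodic_double_root (R : realType) (a0 a1 a2 a3 x : R) :
  0 < a0 -> 0 < a1 -> 0 < a2 -> 0 < a3 ->
  double_root (floquet_poly a0 a1 a2 a3 0 0 0 0 1) x -> a0 * a2 = a1 * a3.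
Proof.
move=> p0 p1 p2 p3 /double_root_cofactors; rewrite !(expr1n, mul1r, subr0) =>
  -[//|p q].
have /eqP : (a0 * a1 + a2 * a3) * x = 0 by rewrite mulrDl.
rewrite mulf_eq0 gt_eqF ?addr_gt0 ?mulr_gt0 //= => /eqP -> r.
have /eqP : a2 * (a1 * a3 - a0 * a2) = 0 by rewrite -[RHS]r; ring.
by rewrite mulf_eq0 gt_eqF //= subr_eq0 => /eqP.
Qed.

(** Here [x = 0] would make the cofactor at (0,1) negative; dividing by [x], the
    other two give [a0 * a1 = a2 * a3] and [a1 * a2 = a0 * a3]. *)
Lemma ODJM_antiperiodic_double_root (R : realType) (a0 a1 a2 a3 x : R) :
  0 < a0 -> 0 < a1 -> 0 < a2 -> 0 < a3 ->
  double_root (floquet_poly a0 a1 a2 a3 0 0 0 0 (-1)) x -> a0 = a2 /\ a1 = a3.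
Proof.
move=> p0 p1 p2 p3 /double_root_cofactors; rewrite !(sqrrN, expr1n, subr0) =>
  -[//|p q r].
have x0 : x != 0.
  apply/eqP => x0; move: r; rewrite x0 => r.
  have : 0 < a0 * a2 ^+ 2 by rewrite mulr_gt0 ?exprn_gt0.
  have : 0 < a1 * a2 * a3 by rewrite !mulr_gt0.
  lra.
have e1 : a0 * a1 = a2 * a3.
  by apply/eqP; rewrite -subr_eq0 -(mulIr_eq0 _ (mulIf x0)); apply/eqP;
    rewrite -[RHS]p; ring.
have e2 : a1 * a2 = a0 * a3.
  by apply/eqP; rewrite -subr_eq0 -(mulIr_eq0 _ (mulIf x0)); apply/eqP;
    rewrite -[RHS]q; ring.
have : (a1 - a3) * (a0 + a2) = 0 by lra.
have : (a0 - a2) * (a1 + a3) = 0 by lra.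
move=> /eqP; rewrite mulf_eq0 [X in _ || X]gt_eqF ?addr_gt0 // orbF => /eqP ?.
move=> /eqP; rewrite mulf_eq0 [X in _ || X]gt_eqF ?addr_gt0 // orbF => /eqP ?.
by split; lra.
Qed.

(** * Cyclic shifts and irreducibility *)

Lemma row4_eq (R : realType) (x0 x1 x2 x3 y0 y1 y2 y3 : R) :
  (row4 x0 x1 x2 x3 == row4 y0 y1 y2 y3)
  = [&& x0 == y0, x1 == y1, x2 == y2 & x3 == y3].
Proof.
apply/eqP/and4P => [/rowP h|[/eqP-> /eqP-> /eqP-> /eqP->] //].
have := (h (@Ordinal 4 0 isT), h (@Ordinal 4 1 isT),
         h (@Ordinal 4 2 isT), h (@Ordinal 4 3 isT)).
by rewrite !mxE /= => -[[[-> ->] ->] ->]; rewrite !eqxx.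
Qed.

Lemma row4_eta (R : realType) (v : 'rV[R]_4) :
  exists v0 v1 v2 v3, v = row4 v0 v1 v2 v3.
Proof.
exists (v 0 (@Ordinal 4 0 isT)), (v 0 (@Ordinal 4 1 isT)),
  (v 0 (@Ordinal 4 2 isT)), (v 0 (@Ordinal 4 3 isT)).
apply/rowP => i; rewrite mxE.
by case: i => [[|[|[|[|i]]]] Hi] //=; congr (v 0 _); apply: val_inj.
Qed.

Lemma const_row4 (R : realType) (c : R) : const_mx c = row4 c c c c.
Proof. by apply/rowP => -[[|[|[|[|i]]]] Hi] //; rewrite !mxE. Qed.

Lemma cyc_row4 (R : realType) (x0 x1 x2 x3 : R) :
  cyc (row4 x0 x1 x2 x3) = row4 x1 x2 x3 x0.
Proof. by apply/rowP => -[[|[|[|[|i]]]] Hi] //; rewrite !mxE. Qed.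

(** A vector fixed by a nontrivial shift is fixed by the shift by two, whose
    class lies in every nontrivial subgroup of the cyclic group of order 4. *)
Lemma irreducible_row4 (R : realType) (x0 x1 x2 x3 : R) :
  irreducible (row4 x0 x1 x2 x3) = ~~ ((x0 == x2) && (x1 == x3)).
Proof.
rewrite /irreducible /= !cyc_row4 !inE !row4_eq.
rewrite (eq_sym x1 x0) (eq_sym x2 x0) (eq_sym x3 x0) (eq_sym x2 x1).
rewrite (eq_sym x3 x1) (eq_sym x3 x2).
by case: (x0 =P x1); case: (x0 =P x2); case: (x0 =P x3); case: (x1 =P x2);
  case: (x1 =P x3); case: (x2 =P x3) => //= *; exfalso; congruence.
Qed.

Lemma floquet_poly_DSO_cyc (R : realType) (v0 v1 v2 v3 c : R) :
  floquet_poly 1 1 1 1 v1 v2 v3 v0 c = floquet_poly 1 1 1 1 v0 v1 v2 v3 c.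
Proof. by rewrite /floquet_poly /cyclic_det expr1n; ring. Qed.

Lemma floquet_poly_DSO_iter_cyc (R : realType) k (v0 v1 v2 v3 w0 w1 w2 w3 c : R) :
  iter k (@cyc R 4) (row4 v0 v1 v2 v3) = row4 w0 w1 w2 w3 ->
  floquet_poly 1 1 1 1 v0 v1 v2 v3 c = floquet_poly 1 1 1 1 w0 w1 w2 w3 c.
Proof.
elim: k v0 v1 v2 v3 => [|k IH] v0 v1 v2 v3.
  by move=> /= /eqP; rewrite row4_eq => /and4P[/eqP-> /eqP-> /eqP-> /eqP->].
by rewrite iterSr cyc_row4 => /IH <-; apply/esym/floquet_poly_DSO_cyc.
Qed.

(** * Gap counts of irreducible parameters *)

Lemma gap_count_DSO_irreducible (R : realType) (v0 v1 v2 v3 : R) :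
  irreducible (row4 v0 v1 v2 v3) ->
  gap_count_DSO (row4 v0 v1 v2 v3) =
  `[< exists x, double_root (floquet_poly 1 1 1 1 v0 v1 v2 v3 1) x >] :> nat.
Proof.
rewrite irreducible_row4 => /negP irr.
rewrite /gap_count_DSO const_row4; apply: gap_count_periodic.
  by rewrite !mulr1 ltr01.
by move=> x /DSO_antiperiodic_double_root[e02 e13]; apply: irr; rewrite e02 e13 !eqxx.
Qed.

Lemma gap_count_ODJM_irreducible (R : realType) (a0 a1 a2 a3 : R) :
  positive (row4 a0 a1 a2 a3) -> irreducible (row4 a0 a1 a2 a3) ->
  gap_count_ODJM (row4 a0 a1 a2 a3) = (a0 * a2 == a1 * a3) :> nat.
Proof.
rewrite irreducible_row4 => a_gt0 /negP irr.
have := (a_gt0 (@Ordinal 4 0 isT), a_gt0 (@Ordinal 4 1 isT),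
         a_gt0 (@Ordinal 4 2 isT), a_gt0 (@Ordinal 4 3 isT)).
rewrite !mxE /= => -[[[p0 p1] p2] p3].
rewrite /gap_count_ODJM const_row4 gap_count_periodic ?mulr_gt0 //; last first.
  move=> x /(ODJM_antiperiodic_double_root p0 p1 p2 p3)[e02 e13].
  by apply: irr; rewrite e02 e13 !eqxx.
congr nat_of_bool; apply/asboolP/eqP => [[x]|e].
  exact: ODJM_periodic_double_root.
(* The periodic polynomial is even, with value [(a0 a2 - a1 a3)^2] at 0. *)
exists 0; apply: double_rootE; last by ring.
transitivity ((a0 * a2 - a1 * a3) ^+ 2); first by rewrite /cyclic_det; ring.
by rewrite e subrr expr0n.
Qed.

(** The two alternatives of [DSO_periodic_double_root] are shifts of each other;
    conversely the periodic polynomial is invariant under shifts, and for the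
    normal form translated by [- c] it has the double root [- c]. *)
Lemma DSO_double_root_shape (R : realType) (v0 v1 v2 v3 : R) :
  irreducible (row4 v0 v1 v2 v3) ->
  (exists x, double_root (floquet_poly 1 1 1 1 v0 v1 v2 v3 1) x) <->
  exists (k : nat) (c lambda : R), lambda != 0 /\
    iter k (@cyc R 4) (row4 v0 v1 v2 v3) + const_mx c = row4 0 lambda 0 (- lambda).
Proof.
have addc (y0 y1 y2 y3 c : R) :
    row4 y0 y1 y2 y3 + const_mx c = row4 (y0 + c) (y1 + c) (y2 + c) (y3 + c).
  by apply/rowP => -[[|[|[|[|i]]]] Hi] //; rewrite !mxE.
rewrite irreducible_row4 => irr; split.
  case=> x /DSO_periodic_double_root[[e0 [e2 e]]|[e1 [e3 e]]].
    exists 0%N, (- x), (v1 - x); split.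
      apply: contra irr => /eqP e1.
      by apply/andP; split; apply/eqP; lra.
    rewrite /= addc; apply/eqP; rewrite row4_eq.
    by apply/and4P; split; apply/eqP; lra.
  exists 1%N, (- x), (v2 - x); split.
    apply: contra irr => /eqP e2.
    by apply/andP; split; apply/eqP; lra.
  rewrite /= cyc_row4 addc; apply/eqP; rewrite row4_eq.
  by apply/and4P; split; apply/eqP; lra.
case=> k [c [lambda [_ e]]].
have {}e : iter k (@cyc R 4) (row4 v0 v1 v2 v3)
    = row4 (- c) (lambda - c) (- c) (- lambda - c).
  apply: (addIr (const_mx c)); rewrite e addc; apply/eqP; rewrite row4_eq.
  by apply/and4P; split; apply/eqP; ring.
exists (- c); rewrite (floquet_poly_DSO_iter_cyc _ e).
by apply: double_rootE; rewrite /cyclic_det; ring.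
Qed.

Theorem theorem1p8 (R : realType) :
  (is_gap_max_DSO R 4 1
   /\ forall v : 'rV[R]_4, irreducible v ->
        (gap_count_DSO v = 1%N <->
         exists (k : nat) (c lambda : R),
           lambda != 0 /\
           iter k (@cyc R 4) v + const_mx c = row4 0 lambda 0 (- lambda)))
  /\
  (is_gap_max_ODJM R 4 1
   /\ forall a1 a2 a3 a4 : R,
        positive (row4 a1 a2 a3 a4) -> irreducible (row4 a1 a2 a3 a4) ->
        (gap_count_ODJM (row4 a1 a2 a3 a4) = 1%N <-> a1 * a3 = a2 * a4)).
Proof.
have dso (v : 'rV[R]_4) : irreducible v -> (gap_count_DSO v = 1%N <->
    exists (k : nat) (c lambda : R), lambda != 0 /\
      iter k (@cyc R 4) v + const_mx c = row4 0 lambda 0 (- lambda)).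
  have [v0 [v1 [v2 [v3 ->]]]] := row4_eta v => irr.
  apply: (iff_trans _ (DSO_double_root_shape irr)).
  by rewrite gap_count_DSO_irreducible //; case: asboolP.
have odjm (a1 a2 a3 a4 : R) : positive (row4 a1 a2 a3 a4) ->
    irreducible (row4 a1 a2 a3 a4) ->
    (gap_count_ODJM (row4 a1 a2 a3 a4) = 1%N <-> a1 * a3 = a2 * a4).
  move=> pos irr; rewrite gap_count_ODJM_irreducible //.
  by case: eqP.
split; split=> //; split.
- have irr : irreducible (row4 0 1 0 (- 1) : 'rV[R]_4).
    rewrite irreducible_row4 eqxx /=; apply/eqP; lra.
  exists (row4 0 1 0 (- 1)) => //; apply/(dso _ irr).
  exists 0%N, 0, 1; split; first exact: oner_neq0.
  by rewrite /= (_ : const_mx 0 = 0) ?addr0.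
- move=> _ [v irr <-]; move: irr; have [v0 [v1 [v2 [v3 ->]]]] := row4_eta v => irr.
  by rewrite gap_count_DSO_irreducible //; case: asboolP.
- have irr : irreducible (row4 1 2 4 2 : 'rV[R]_4).
    rewrite irreducible_row4 negb_and; apply/orP; left; apply/eqP; lra.
  have pos : positive (row4 1 2 4 2 : 'rV[R]_4).
    by move=> -[[|[|[|[|i]]]] Hi] //; rewrite !mxE /=; lra.
  exists (row4 1 2 4 2) => //; apply/(odjm _ _ _ _ pos irr); lra.
- move=> _ [a [pos irr] <-]; move: pos irr.
  have [a0 [a1 [a2 [a3 ->]]]] := row4_eta a => pos irr.
  by rewrite gap_count_ODJM_irreducible //; case: eqP.
Qed.
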